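(* Let $K$ be a field containing $\mathbb{F}_q$, $W$ an $\mathbb{F}_q$-subspace of $K$ with $\dim_{\mathbb{F}_q}W=n\ge1$, $\underline w=(w_1,\dots,w_n)$ an $\mathbb{F}_q$-basis of $W$ and $(w_1^\star,\dots,w_n^\star)$ its dual basis. For $1\le j\le n$ put $$\omega_j:=\sum_{(\epsilon_1,\dots,\epsilon_n)\in\mathbb{F}_q^n}\frac{\epsilon_j\,dX}{X-\sum_{i=1}^n\epsilon_iw_i}\in\Omega^1_K(K(X)).$$ Let $\underline\alpha=(\alpha_1,\dots,\alpha_n)\in\mathbb{F}_q^n\setminus\{(0,\dots,0)\}$, $\varphi=\sum_{i=1}^n\alpha_iw_i^\star$, and $$\omega_\varphi:=\sum_{j=1}^n\alpha_j\omega_j=\sum_{(\epsilon_1,\dots,\epsilon_n)\in\mathbb{F}_q^n}\frac{\sum_{j=1}^n\alpha_j\epsilon_j}{X-\sum_{i=1}^n\epsilon_iw_i}\,dX .$$ Then $$\omega_\varphi=-\Delta_n(\underline w)^{q-1}\,\frac{\Delta_\varphi(\underline w,X)}{\Delta_{n+1}(\underline w,X)}\,dX,$$ and $\Delta_\varphi(\underline w,X)$ divides $\Delta_{n+1}(\underline w,X)$ in $K[X]$. Thus, setting $\mu+1:=q^{n-1}(q-1)$ (and assuming that $\mu\ge2$ and that $\mu$ is prime to $p$), the space $\Omega_W:=\sum_{j=1}^n\mathbb{F}_q\omega_j\subset\Omega^1_K(K(X))$ is an $L^q_{\mu+1,n}$-space.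
   Context: $q=p^s$ is a power of a prime $p$. For a commutative ring $A$ containing $\mathbb{F}_q$ and $\underline a=(a_1,\dots,a_n)\in A^n$, $\Delta_n(\underline a):=\det\big(a_j^{q^{i-1}}\big)_{1\le i,j\le n}$ is the Moore determinant; $\Delta_{n+1}(\underline w,X)$ is the Moore determinant of $(w_1,\dots,w_n,X)$ in $K[X]$. For $\varphi=\sum_i\alpha_iw_i^\star$, $\Delta_\varphi(\underline w,X)$ is the determinant of the $(n+1)\times(n+1)$ matrix over $K[X]$ whose first row is $(\alpha_1,\dots,\alpha_n,0)$ and whose $(k+2)$-th row, for $0\le k\le n-1$, is $(w_1^{q^k},\dots,w_n^{q^k},X^{q^k})$. Definition ($L^q_{\mu+1,n}$-space): let $\mu\ge2$ be an integer prime to $p$ and $n\ge1$. An $L^q_{\mu+1,n}$-space is an $\mathbb{F}_q$-vector space of dimension $n$ of differential forms in $\Omega^1_K(K(X))$ (differentials on the projective line over $K$) each nonzero element of which has divisor of zeros equal to $(\mu-1)\infty$, has only simple poles, all located in $K$ (so there are $\mu+1$ poles), and has all residues in $\mathbb{F}_q$. *)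

(* Defs.v *)
From HB Require Import structures.
From mathcomp Require Import all_boot all_order all_algebra.

Set Implicit Arguments.
Unset Strict Implicit.
Unset Printing Implicit Defensive.

Import GRing.Theory.
Local Open Scope ring_scope.
Local Open Scope quotient_scope.

(* An inclusion of F = F_q in a field K is a ring morphism iota : F -> K, and  *)
(* F-vector spaces inside a larger additive group V are handled through an     *)
(* explicit scalar multiplication sc : F -> V -> V.                            *)

Definition Flincomb (F : finFieldType) (V : zmodType) (sc : F -> V -> V)
    (n : nat) (b : 'I_n -> V) (c : 'I_n -> F) : V :=
  \sum_(i < n) sc (c i) (b i).

Definition Fspan (F : finFieldType) (V : zmodType) (sc : F -> V -> V)
    (n : nat) (b : 'I_n -> V) (v : V) : Prop :=
  exists c : 'I_n -> F, v = Flincomb sc b c.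

Definition Findependent (F : finFieldType) (V : zmodType) (sc : F -> V -> V)
    (n : nat) (b : 'I_n -> V) : Prop :=
  forall c : 'I_n -> F, Flincomb sc b c = 0 -> forall i, c i = 0.

(* In particular S is an F-subspace of V, of dimension n. *)
Definition is_Fbasis (F : finFieldType) (V : zmodType) (sc : F -> V -> V)
    (S : V -> Prop) (n : nat) (b : 'I_n -> V) : Prop :=
  (forall v, S v <-> Fspan sc b v) /\ Findependent sc b.

Definition Fscale (F : finFieldType) (K : fieldType) (iota : {rmorphism F -> K})
    (c : F) (x : K) : K := iota c * x.

(* Linear forms on the F-subspace W of K are functions K -> F of which only    *)
(* the values on W matter.                                                     *)
Definition linear_form_on (F : finFieldType) (K : fieldType)
    (iota : {rmorphism F -> K}) (W : K -> Prop) (f : K -> F) : Prop :=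
  forall (c : F) (u v : K), W u -> W v ->
    f (Fscale iota c u + v) = c * f u + f v.

Definition is_dual_basis (F : finFieldType) (K : fieldType)
    (iota : {rmorphism F -> K}) (W : K -> Prop) (n : nat) (w : 'I_n -> K)
    (wstar : 'I_n -> K -> F) : Prop :=
  (forall i, linear_form_on iota W (wstar i)) /\
  (forall i j, wstar i (w j) = (i == j)%:R).

Definition snoc (T : Type) (n : nat) (a : 'I_n -> T) (x : T) : 'I_n.+1 -> T :=
  fun j => if unlift ord_max j is Some k then a k else x.

Definition Moore (A : comNzRingType) (q n : nat) (a : 'I_n -> A) : A :=
  \det (\matrix_(i < n, j < n) a j ^+ (q ^ i)%N).

Definition MooreX (K : fieldType) (q n : nat) (w : 'I_n -> K) : {poly K} :=
  Moore q (snoc (fun i => (w i)%:P) 'X).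

(* If phi = \sum_i alpha_i w_i^* then alpha_j = phi (w_j), so that the first   *)
(* row is (alpha_1, ..., alpha_n, 0).                                          *)
Definition MoorePhi (F : finFieldType) (K : fieldType)
    (iota : {rmorphism F -> K}) (q n : nat) (phi : K -> F) (w : 'I_n -> K) :
    {poly K} :=
  \det (\matrix_(i < n.+1, j < n.+1)
    if unlift ord0 i is Some k
    then snoc (fun l => (w l)%:P) 'X j ^+ (q ^ k)%N
    else snoc (fun l => (iota (phi (w l)))%:P) 0 j).

Notation ratfun K := {fraction {poly K}}.
Notation "f %:F" := (tofrac f) : ring_scope.

(* The differentials of K(X) over K form the K(X)-line with basis dX: the      *)
(* differential f dX is represented by its coordinate f.                       *)
Notation Omega1 K := ({fraction {poly K}}^o).

Definition dX (K : fieldType) : Omega1 K := (1 : ratfun K).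

Definition coord_dX (K : fieldType) (om : Omega1 K) : ratfun K := om.

Lemma coord_dXK (K : fieldType) (om : Omega1 K) : coord_dX om *: dX K = om.
Proof. exact: mulr1. Qed.

Lemma coord_dXZ (K : fieldType) (f : ratfun K) : coord_dX (f *: dX K) = f.
Proof. exact: mulr1. Qed.

Definition Omega_scale (F : finFieldType) (K : fieldType)
    (iota : {rmorphism F -> K}) (c : F) (om : Omega1 K) : Omega1 K :=
  (iota c)%:P%:F *: om.

(* Closed points of the projective line over K: those of the affine line are   *)
(* the monic irreducible polynomials (see is_place), and there is the point at *)
(* infinity.                                                                   *)
Variant place (K : fieldType) := FinitePlace of {poly K} | InfinitePlace.
Arguments InfinitePlace {K}.

Definition is_place (K : fieldType) (v : place K) : Prop :=
  match v with
  | FinitePlace P => P \is monic /\ irreducible_poly P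
  | InfinitePlace => True
  end.

Definition rational_place (K : fieldType) (x : K) : place K :=
  FinitePlace ('X - x%:P).

(* The multiplicity of P in f, for f != 0 and P nonconstant: P ^+ k %| f then  *)
(* implies k < size f.                                                         *)
Definition mult_poly (K : fieldType) (P f : {poly K}) : nat :=
  \max_(k < size f | P ^+ k %| f) k.

Definition ord_ratfun (K : fieldType) (v : place K) (f : ratfun K) : int :=
  let num := \n_(repr f) in
  let den := \d_(repr f) in
  match v with
  | FinitePlace P => (mult_poly P num)%:Z - (mult_poly P den)%:Z
  | InfinitePlace => (size den)%:Z - (size num)%:Z
  end.

(* dX generates the differentials at every finite place, and has a double pole *)
(* at infinity. The value is meaningful for nonzero differentials.             *)
Definition ord_form (K : fieldType) (v : place K) (om : Omega1 K) : int :=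
  ord_ratfun v (coord_dX om) - (if v is InfinitePlace then 2 else 0).

Definition zero_order (K : fieldType) (v : place K) (om : Omega1 K) : int :=
  Num.max 0 (ord_form v om).

Definition is_pole (K : fieldType) (v : place K) (om : Omega1 K) : Prop :=
  is_place v /\ ord_form v om < 0.

Definition regular_at (K : fieldType) (x : K) (f : ratfun K) : Prop :=
  exists a b : {poly K}, b.[x] != 0 /\ f = a%:F / b%:F.

(* Subtracting the polar part \sum_(1 <= k <= m) c k / (X - x)^k of the        *)
(* Laurent expansion at x leaves a function regular at x; the residue is c 1.  *)
Definition is_residue (K : fieldType) (x : K) (om : Omega1 K) (r : K) : Prop :=
  exists (m : nat) (c : nat -> K),
    [/\ (0 < m)%N, c 1%N = r &
        regular_at x (coord_dX om -
          \sum_(1 <= k < m.+1)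
             (c k)%:P%:F / ('X - x%:P)%:F ^+ k)].

Definition zero_divisor_at_infinity (K : fieldType) (mu : nat)
    (om : Omega1 K) : Prop :=
  forall v : place K, is_place v ->
    zero_order v om = if v is InfinitePlace then mu%:Z - 1 else 0.

Definition simple_rational_poles (K : fieldType) (om : Omega1 K) : Prop :=
  forall v : place K, is_pole v om ->
    ord_form v om = - 1 /\ exists x : K, v = rational_place x.

Definition residues_in (F : finFieldType) (K : fieldType)
    (iota : {rmorphism F -> K}) (om : Omega1 K) : Prop :=
  forall x : K, is_pole (rational_place x) om ->
    exists e : F, is_residue x om (iota e).

(* The L^q_(mu+1,n)-spaces, for F = F_q of characteristic p. *)
Definition is_Lspace (F : finFieldType) (K : fieldType)
    (iota : {rmorphism F -> K}) (p mu n : nat) (S : Omega1 K -> Prop) : Prop :=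
  [/\ [/\ (2 <= mu)%N, coprime mu p & (1 <= n)%N],
      exists b : 'I_n -> Omega1 K, is_Fbasis (Omega_scale iota) S b &
      forall om, S om -> om != 0 ->
        [/\ zero_divisor_at_infinity mu om, simple_rational_poles om
          & residues_in iota om]].

Definition omega (F : finFieldType) (K : fieldType) (iota : {rmorphism F -> K})
    (n : nat) (w : 'I_n -> K) (j : 'I_n) : Omega1 K :=
  \sum_(eps : {ffun 'I_n -> F})
    ((iota (eps j))%:P%:F /
     ('X - (\sum_(i < n) iota (eps i) * w i)%:P)%:F) *: dX K.

Definition omega_phi (F : finFieldType) (K : fieldType)
    (iota : {rmorphism F -> K}) (n : nat) (w : 'I_n -> K) (alpha : 'I_n -> F) :
    Omega1 K :=
  \sum_(j < n) Omega_scale iota (alpha j) (omega iota w j).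

Definition Omega_W (F : finFieldType) (K : fieldType)
    (iota : {rmorphism F -> K}) (n : nat) (w : 'I_n -> K) : Omega1 K -> Prop :=
  Fspan (Omega_scale iota) (omega iota w).

(* Main.v *)
Require Import Defs.
From HB Require Import structures.
From mathcomp Require Import all_boot all_order all_algebra.
From mathcomp Require Import finfield.

(* The poles of omega_phi are the points v of W, with residue phi(v), so
   omega_phi = N/P dX, where P is the product of the X - v and N is the
   interpolation polynomial with N(v) = phi(v) P'(v). Expanding Moore determinants
   along their last column shows that they are q-polynomials in X, hence
   F_q-linear on W. Therefore Delta_(n+1)(w, X) = Delta_n(w) P, whose derivative
   is the constant (-1)^n Delta_n(w)^q, while Delta_phi(w, v) is
   (-1)^(n+1) Delta_n(w) phi(v): this determines N. By degree Delta_phi is, up to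
   a nonzero constant, the product of the X - v for v in ker phi, so omega_phi is
   a constant over the product of the X - v for v in W \ ker phi. *)

Set Implicit Arguments.
Unset Strict Implicit.
Unset Printing Implicit Defensive.

Import Order.TTheory GRing.Theory Num.Theory.
Local Open Scope ring_scope.

(** * Expansion of a determinant along its last column *)

Section LastColumn.

Variables (R : comNzRingType) (n : nat).

Lemma snoc_lift (T : Type) (a : 'I_n -> T) x k :
  snoc a x (lift ord_max k) = a k.
Proof. by rewrite /snoc liftK. Qed.

Lemma snoc_max (T : Type) (a : 'I_n -> T) x : snoc a x ord_max = x.
Proof. by rewrite /snoc unlift_none. Qed.

(** The cofactor of the entry in row [i] of the last column. It involves only the first [n] columns,
    so it stays constant when the last column consists of powers of X. *)
Definition last_cofactor (M : 'I_n.+1 -> 'I_n -> R) (i : 'I_n.+1) : R :=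
  (-1) ^+ (i + n) * \det (\matrix_(k < n, l < n) M (lift i k) l).

Lemma det_snoc (M : 'I_n.+1 -> 'I_n -> R) (c : 'I_n.+1 -> R) :
  \det (\matrix_(i < n.+1, j < n.+1) snoc (M i) (c i) j) =
  \sum_i c i * last_cofactor M i.
Proof.
rewrite (expand_det_col _ ord_max); apply: eq_bigr => i _.
rewrite !mxE snoc_max /cofactor /last_cofactor; congr (_ * (_ * \det _)).
by apply/matrixP=> k l; rewrite !mxE snoc_lift.
Qed.

Lemma last_cofactor0 (M : 'I_n.+1 -> 'I_n -> R) :
  last_cofactor M ord0 =
  (-1) ^+ n * \det (\matrix_(k < n, l < n) M (lift ord0 k) l).
Proof. by rewrite /last_cofactor add0n. Qed.

Lemma last_cofactor_max (M : 'I_n.+1 -> 'I_n -> R) :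
  last_cofactor M ord_max = \det (\matrix_(k < n, l < n) M (lift ord_max k) l).
Proof. by rewrite /last_cofactor /= -signr_odd oddD addbb mul1r. Qed.

(** The sum is the determinant whose last column is a copy of column [j], hence has two equal
    columns. *)
Lemma last_cofactor_col (M : 'I_n.+1 -> 'I_n -> R) (j : 'I_n) :
  \sum_i M i j * last_cofactor M i = 0.
Proof.
rewrite -det_snoc -det_tr.
apply: (@determinant_alternate _ _ _ (lift ord_max j) ord_max).
  by rewrite eq_sym neq_lift.
by move=> i; rewrite !mxE snoc_lift snoc_max.
Qed.

End LastColumn.

(** Used with [polyC]: cofactors of a matrix of constant polynomials are constants, so they can
    serve as coefficients in K. *)
Lemma last_cofactor_map (R S : comNzRingType) (f : {rmorphism R -> S}) (n : nat)
    (M : 'I_n.+1 -> 'I_n -> R) (N : 'I_n.+1 -> 'I_n -> S) i :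
  (forall i l, N i l = f (M i l)) -> last_cofactor N i = f (last_cofactor M i).
Proof.
move=> NM; rewrite /last_cofactor rmorphM rmorphXn rmorphN1 -det_map_mx.
by congr (_ * \det _); apply/matrixP=> k l; rewrite !mxE NM.
Qed.

(** * Interpolation on a finite set of points and sums of simple fractions *)

Section PolynomialRoots.

Variables (K : fieldType) (E : finType) (x : E -> K).
Hypothesis x_inj : injective x.

Lemma poly_eq0_on_image (f : {poly K}) :
  (size f <= #|E|)%N -> (forall e, f.[x e] = 0) -> f = 0.
Proof.
move=> sz_f f0; apply: (@roots_geq_poly_eq0 _ f [seq x e | e : E]).
- by apply/allP=> _ /mapP[e _ ->]; apply/eqP.
- by rewrite map_inj_uniq ?enum_uniq.
- by rewrite size_map -cardE.
Qed.

Lemma poly_eq_on_image (f g : {poly K}) :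
    (size f <= #|E|)%N -> (size g <= #|E|)%N ->
  (forall e, f.[x e] = g.[x e]) -> f = g.
Proof.
move=> sf sg fg; apply/eqP; rewrite -subr_eq0; apply/eqP.
apply: poly_eq0_on_image => [|e]; last by rewrite !hornerE fg subrr.
by rewrite (leq_trans (size_polyD _ _)) // size_polyN geq_max sf.
Qed.

Lemma size_prod_XsubC_pred (A : pred E) :
  size (\prod_(e | A e) ('X - (x e)%:P)) = #|A|.+1.
Proof. by rewrite -(big_enum _ _ A) size_prod_XsubC -cardE. Qed.

(** These products are the Lagrange polynomials of the points [x u], up to normalisation by the
    derivative of the full product. *)
Lemma horner_prodD1 (e e' : E) :
  (\prod_(u | u != e) ('X - (x u)%:P)).[x e'] =
  if e' == e then (\prod_(u : E) ('X - (x u)%:P))^`().[x e] else 0.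
Proof.
case: eqP => [->|/eqP ne].
  rewrite [in RHS](bigD1 e) //= derivM derivXsubC mul1r hornerD hornerM.
  by rewrite !hornerE subrr mul0r addr0.
by rewrite (bigD1 e') //= hornerM hornerXsubC subrr mul0r.
Qed.

Lemma size_prodD1 (e : E) :
  size (\prod_(u | u != e) ('X - (x u)%:P)) = #|E|.
Proof.
rewrite size_prod_XsubC_pred (eq_card (B := predC1 e)) // cardC1 prednK //.
by apply/card_gt0P; exists e.
Qed.

Lemma sum_simple_poles (c : E -> K) :
  \sum_e (c e)%:P%:F / ('X - (x e)%:P)%:F =
  (\sum_e c e *: \prod_(u | u != e) ('X - (x u)%:P))%:F /
    (\prod_e ('X - (x e)%:P))%:F.
Proof.
rewrite rmorph_sum mulr_suml; apply: eq_bigr => e _.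
rewrite [X in _ = _ / X%:F](bigD1 e) //= -mul_polyC !rmorphM /=.
set D := \prod_(_ | _) _; have D0 : D%:F != 0.
  by rewrite tofrac_eq0 -size_poly_gt0 size_prod_XsubC_pred.
by rewrite -mulf_div divff // mulr1.
Qed.

End PolynomialRoots.

Lemma size_sum_expX (K : fieldType) (q m : nat) (B : 'I_m -> K) :
  (0 < q)%N -> (size (\sum_(i < m) B i *: 'X^(q ^ i))%R <= (q ^ m.-1).+1)%N.
Proof.
move=> q0; apply: (leq_trans (size_sum _ _ _)); apply/bigmax_leqP=> i _.
rewrite (leq_trans (size_scale_leq _ _)) // size_polyXn ltnS leq_pexp2l //.
by rewrite -ltnS (ltn_predK (ltn_ord i)).
Qed.

(** * Kernel of a nonzero linear form over a finite field *)

Section LinearFormCard.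

Variables (F : finFieldType) (n : nat) (a : 'I_n -> F).
Hypothesis a_neq0 : exists i, a i != 0.

(** Translations permute the fibres of the form transitively, so the [#|F|] fibres all have the size
    of the kernel and together fill a set of size [#|F| ^ n]. *)
Lemma card_linear_form_ker :
  #|[pred e : {ffun 'I_n -> F} | \sum_i a i * e i == 0]| = (#|F| ^ n.-1)%N.
Proof.
case: a_neq0 => i0 ai0; set N := #|_|.
(* A vector on which the form takes the value [t], supported at a coordinate where [a] is
   nonzero. *)
pose u t : {ffun 'I_n -> F} := [ffun i => if i == i0 then t / a i0 else 0].
pose f (e : {ffun 'I_n -> F}) := \sum_i a i * e i.
have fD e t : f (e + u t) = f e + t.
  rewrite /f (eq_bigr (fun i => a i * e i + a i * u t i)); last first.
    by move=> i _; rewrite ffunE mulrDr.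
  rewrite big_split /=; congr (_ + _).
  rewrite (bigD1 i0) //= ffunE eqxx big1 ?addr0 => [|i /negPf ni].
    by rewrite mulrC divfK.
  by rewrite ffunE ni mulr0.
have: #|{ffun 'I_n -> F}| = (#|F| * N)%N.
  rewrite -sum1_card (partition_big f predT) //= -sum_nat_const.
  apply: eq_bigr => t _; rewrite (reindex_inj (addIr (u t))) /= /N -sum1_card.
  by apply: eq_bigl => e; rewrite fD -subr_eq0 addrK inE.
rewrite card_ffun card_ord => /eqP.
have n0 : (0 < n)%N by apply: leq_ltn_trans (ltn_ord i0).
rewrite -[in (_ ^ n)%N](prednK n0) expnS eqn_pmul2l; first by move/eqP.
by apply/card_gt0P; exists 0.
Qed.

End LinearFormCard.

(** * Moore determinants as q-polynomials *)

Section MooreDeterminants.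

Variables (p s : nat) (F : finFieldType) (K : fieldType).
Variables (iota : {rmorphism F -> K}) (n : nat) (w : 'I_n -> K).
Hypotheses (p_pr : prime p) (cardF : #|F| = (p ^ s)%N) (n_gt0 : (0 < n)%N).
Hypothesis w_indep : Findependent (Fscale iota) w.

Local Notation q := #|F|.
Local Notation E := {ffun 'I_n -> F}.

Let x (e : E) : K := \sum_i iota (e i) * w i.
Let P := \prod_(e : E) ('X - (x e)%:P).

Let card_coeffs : #|{: E}| = (q ^ n)%N.
Proof. by rewrite card_ffun card_ord. Qed.

Let q_gt1 : (1 < q)%N. Proof. exact: finNzRing_gt1. Qed.

Let q_gt0 : (0 < q)%N. Proof. exact: ltnW. Qed.

Let ltn_expq_card : (q ^ n.-1 < #|{: E}|)%N.
Proof. by rewrite card_coeffs ltn_exp2l // prednK. Qed.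

Let pcharK : p \in [pchar K].
Proof. exact: rmorph_pchar iota _ (card_finPcharP cardF p_pr). Qed.

Lemma lin_comb_inj : injective x.
Proof.
move=> e e' eq_x; apply/ffunP=> i; apply/eqP; rewrite -subr_eq0; apply/eqP.
move: i; apply: (w_indep (c := fun i => e i - e' i)).
rewrite /Flincomb /Fscale; apply/eqP.
rewrite (eq_bigr (fun i => iota (e i) * w i - iota (e' i) * w i)); last first.
  by move=> j _; rewrite rmorphB mulrBl.
by rewrite sumrB subr_eq0; apply/eqP.
Qed.

(** With q a power of the characteristic, raising to the power [q ^ k] is additive. *)
Lemma pnat_expq k : [pchar K].-nat (q ^ k)%N.
Proof.
by rewrite (eq_pnat _ (pcharf_eq pcharK)) cardF -expnM pnatX pnat_id.
Qed.

Lemma expq_sum (I : finType) (f : I -> K) k :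
  (\sum_i f i) ^+ (q ^ k) = \sum_i f i ^+ (q ^ k).
Proof.
apply: (big_morph (fun y => y ^+ (q ^ k))) => [y z|].
  exact: exprDn_pchar (pnat_expq k).
by rewrite expr0n -[_ == 0%N]negbK -lt0n expn_gt0 q_gt0.
Qed.

Lemma iota_expq c k : iota c ^+ (q ^ k) = iota c.
Proof.
by elim: k => [|k IHk]; rewrite ?expr1 // expnS exprM -rmorphXn expf_card IHk.
Qed.

Lemma lin_comb_expq e k :
  x e ^+ (q ^ k) = \sum_i iota (e i) * w i ^+ (q ^ k).
Proof.
by rewrite expq_sum; apply: eq_bigr => i _; rewrite exprMn iota_expq.
Qed.

(** A q-polynomial is F-linear on W: the inner sum on the right is its value at [w j]. *)
Lemma horner_qpoly m (B : 'I_m -> K) e :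
  (\sum_(i < m) B i *: 'X^(q ^ i)).[x e] =
  \sum_j iota (e j) * \sum_(i < m) w j ^+ (q ^ i) * B i.
Proof.
rewrite horner_sum.
under eq_bigr do rewrite hornerZ hornerXn lin_comb_expq mulr_sumr.
rewrite exchange_big /=; apply: eq_bigr => j _; rewrite mulr_sumr.
by apply: eq_bigr => i _; rewrite mulrCA [B i * _]mulrC.
Qed.

(** A row vector killed by the Moore matrix gives the coefficients of a q-polynomial vanishing at
    every [w j], hence at the [q ^ n] points of W. Its degree is at most [q ^ n.-1], so it is zero
    and so is the vector. *)
Lemma Moore_neq0 : Moore q w != 0.
Proof.
apply/negP=> /det0P[v v_neq0 vA0]; case/negP: v_neq0.
have f0 : \sum_(i < n) v 0 i *: 'X^(q ^ i) = 0 :> {poly K}.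
  apply: (poly_eq0_on_image lin_comb_inj) => [|e].
    exact: leq_trans (size_sum_expX _ q_gt0) ltn_expq_card.
  rewrite horner_qpoly big1 // => j _.
  have /rowP/(_ j) := vA0; rewrite !mxE => vAj.
  rewrite (_ : \sum_i _ = 0) ?mulr0 // -[RHS]vAj.
  by apply: eq_bigr => i _; rewrite !mxE mulrC.
apply/eqP/rowP=> i; have /polyP/(_ (q ^ i)%N) := f0.
rewrite coef0 coef_sum (bigD1 i) //= big1 => [|k].
  by rewrite coefZ coefXn eqxx mulr1 addr0 mxE.
by rewrite -val_eqE coefZ coefXn eqn_exp2l // eq_sym /= => /negPf ->; rewrite mulr0.
Qed.

Let C := last_cofactor (fun (i : 'I_n.+1) l => w l ^+ (q ^ i)).

Lemma MooreX_sum : MooreX q w = \sum_(i < n.+1) C i *: 'X^(q ^ i).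
Proof.
pose N (i : 'I_n.+1) l := (w l ^+ (q ^ i))%:P.
rewrite /MooreX /Moore.
rewrite (_ : \matrix_(_, _) _ = \matrix_(i, j) snoc (N i) 'X^(q ^ i) j).
  rewrite det_snoc; apply: eq_bigr => i _.
  by rewrite (@last_cofactor_map _ _ polyC _ (fun i l => w l ^+ (q ^ i)) N) // mulrC mul_polyC.
apply/matrixP=> i j; rewrite !mxE /snoc; case: unlift => [k|] //.
by rewrite /N polyC_exp.
Qed.

(** Both sides vanish on W, by linearity and repeated columns on the left. Their terms of degree
    [q ^ n] agree, so the difference has too small a degree for its roots. *)
Lemma MooreX_prod : MooreX q w = Moore q w *: P.
Proof.
apply/eqP; rewrite -subr_eq0; apply/eqP.
have szX : (size (MooreX q w) <= (q ^ n).+1)%N.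
  by rewrite MooreX_sum; apply: size_sum_expX.
have szP : size P = (q ^ n).+1.
  by rewrite size_prod_XsubC_pred -card_coeffs.
apply: (poly_eq0_on_image lin_comb_inj) => [|e].
  rewrite card_coeffs; apply/leq_sizeP=> j; rewrite leq_eqVlt => /orP[/eqP <-|lt_j].
    rewrite coefB coefZ (_ : P`_(q ^ n) = 1); last first.
      have: P \is monic by apply: monic_prod_XsubC.
      by rewrite monicE /lead_coef szP => /eqP.
    rewrite MooreX_sum coef_sum (bigD1 ord_max) //= big1 => [|i].
      (* The top coefficient is the minor obtained by deleting the last row, which is
         [Moore q w]. *)
      rewrite coefZ coefXn eqxx addr0 !mulr1 /C last_cofactor_max.
      apply/eqP; rewrite subr_eq0; apply/eqP; congr (\det _).
      by apply/matrixP=> i j0; rewrite !mxE lift_max.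
    by rewrite -val_eqE coefZ coefXn eqn_exp2l // eq_sym /= => /negPf ->; rewrite mulr0.
  rewrite coefB coefZ !nth_default ?mulr0 ?subr0 ?szP //.
  exact: leq_trans szX _.
rewrite hornerD hornerN hornerZ /P (bigD1 e) //= hornerM hornerXsubC subrr.
rewrite mul0r mulr0 subr0 MooreX_sum horner_qpoly big1 // => j _.
by rewrite last_cofactor_col mulr0.
Qed.

(** In characteristic p only the monomial X of the q-polynomial has a nonzero derivative. Its
    coefficient is, up to sign, the Moore determinant with every entry raised to the power q. *)
Lemma deriv_prod_lin_comb e : Moore q w * P^`().[x e] = (-1) ^+ n * Moore q w ^+ q.
Proof.
rewrite -hornerZ -derivZ -MooreX_prod MooreX_sum big_ord_recl derivD hornerD.
rewrite derivZ derivX hornerZ hornerC mulr1 linear_sum big1 => [|i _].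
  rewrite horner0 addr0 /C last_cofactor0; congr (_ * _).
  rewrite /Moore /determinant -[q in RHS]expn1 expq_sum; apply: eq_bigr => t _.
  (* The sign of a permutation is the image of an element of F, so it is fixed by the q-th power
     whatever the parity of q. *)
  rewrite exprMn -(rmorph_sign iota) iota_expq rmorph_sign -prodrXl.
  congr (_ * _); apply: eq_bigr => i _.
  by rewrite !mxE lift0 expn1 expnSr exprM.
rewrite lift0 /= derivZ derivXn expnS -mulr_natr natrM.
have -> : q%:R = 0 :> {poly K}.
  rewrite -polyC_natr; apply/eqP; rewrite polyC_eq0 -(dvdn_pcharf pcharK) cardF.
  (* The case [s = 0] would give q = 1, against [q_gt1]. *)
  rewrite dvdn_exp //; case: s cardF q_gt1 => // ->.
  by rewrite expn0.
by rewrite mul0r mulr0 scaler0.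
Qed.

(** * The determinant [MoorePhi] and the simple fractions attached to a linear form *)

Section LinearForm.

Variable phi : K -> F.

Let a (j : 'I_n) : F := phi (w j).
Let val_phi (e : E) : F := \sum_j a j * e j.
Let N (i : 'I_n.+1) (l : 'I_n) : K :=
  if unlift ord0 i is Some k then w l ^+ (q ^ k) else iota (a l).

Let N0 l : N ord0 l = iota (a l). Proof. by rewrite /N unlift_none. Qed.

Let NS k l : N (lift ord0 k) l = w l ^+ (q ^ k).
Proof. by rewrite /N liftK. Qed.

(** The zero ending the first row removes its term, so the exponents stop at [q ^ n.-1]. *)
Lemma MoorePhi_sum :
  MoorePhi iota q phi w =
  \sum_(k < n) last_cofactor N (lift ord0 k) *: 'X^(q ^ k).
Proof.
pose c (i : 'I_n.+1) : {poly K} :=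
  if unlift ord0 i is Some k then 'X^(q ^ k) else 0.
rewrite /MoorePhi.
rewrite (_ : \matrix_(_, _) _ = \matrix_(i, j) snoc (fun l => (N i l)%:P) (c i) j).
  rewrite det_snoc big_ord_recl {1}/c unlift_none mul0r add0r.
  apply: eq_bigr => k _; rewrite /c liftK mulrC -mul_polyC.
  by rewrite (@last_cofactor_map _ _ polyC _ N).
apply/matrixP=> i j; rewrite !mxE /snoc /c /N.
by case: (unlift ord_max j) => [l|]; case: (unlift ord0 i) => [k|] //;
  rewrite rmorphXn.
Qed.

(** By linearity it suffices to know the values at the [w j]. There the lower rows of the expansion
    sum to minus the first-row term of [last_cofactor_col], and the first cofactor is [Moore q w] up
    to the sign [(-1) ^+ n]. *)
Lemma horner_MoorePhi e :
  (MoorePhi iota q phi w).[x e] = (-1) ^+ n.+1 * Moore q w * iota (val_phi e).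
Proof.
rewrite MoorePhi_sum horner_qpoly rmorph_sum mulr_sumr; apply: eq_bigr => j _.
have := last_cofactor_col N j; rewrite big_ord_recl N0 last_cofactor0.
under eq_bigr do rewrite NS.
move/eqP; rewrite addrC addr_eq0 => /eqP ->.
rewrite (_ : \det _ = Moore q w); last first.
  by congr (\det _); apply/matrixP=> k l; rewrite !mxE NS.
by rewrite rmorphM mulrN exprS mulN1r !mulNr mulrA mulrC [iota (e j) * _]mulrC.
Qed.

Lemma size_MoorePhi : (size (MoorePhi iota q phi w) <= (q ^ n.-1).+1)%N.
Proof. by rewrite MoorePhi_sum size_sum_expX. Qed.

(** Both sides have size at most [q ^ n], so they are compared at the points of W, where a single
    Lagrange term survives. The factor [Moore q w] on the left makes the derivative computed in
    [deriv_prod_lin_comb] appear. *)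
Lemma numerator_MoorePhi :
  Moore q w *:
    (\sum_e iota (val_phi e) *: \prod_(u | u != e) ('X - (x u)%:P)) =
  - (Moore q w ^+ (q - 1)) *: MoorePhi iota q phi w.
Proof.
apply: (poly_eq_on_image lin_comb_inj) => [||e].
- rewrite (leq_trans (size_scale_leq _ _)) // (leq_trans (size_sum _ _ _)) //.
  apply/bigmax_leqP=> e _; rewrite (leq_trans (size_scale_leq _ _)) //.
  by rewrite size_prodD1.
- rewrite (leq_trans (size_scale_leq _ _)) //.
  exact: leq_trans size_MoorePhi ltn_expq_card.
- rewrite !hornerZ horner_sum (bigD1 e) //= [X in _ + X]big1 ?addr0; last first.
    by move=> u ue; rewrite hornerZ horner_prodD1 eq_sym (negPf ue) mulr0.
  rewrite hornerZ horner_prodD1 eqxx mulrCA deriv_prod_lin_comb horner_MoorePhi.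
  have -> : Moore q w ^+ q = Moore q w ^+ (q - 1) * Moore q w.
    by rewrite -exprSr subn1 prednK.
  rewrite [(-1) ^+ n.+1]exprS mulN1r.
  rewrite !mulNr mulrN opprK.
  by rewrite mulrC -!mulrA mulrCA.
Qed.

Lemma sum_phi_poles :
  \sum_e (iota (val_phi e))%:P%:F / ('X - (x e)%:P)%:F =
  - (Moore q w ^+ (q - 1))%:P%:F *
    ((MoorePhi iota q phi w)%:F / (MooreX q w)%:F).
Proof.
rewrite (sum_simple_poles x (fun e => iota (val_phi e))) -/P mulrA -rmorphN.
rewrite -rmorphN -rmorphM /= mul_polyC -numerator_MoorePhi MooreX_prod.
rewrite -!mul_polyC !rmorphM /= -mulf_div divff ?mul1r //.
by rewrite tofrac_eq0 polyC_eq0 Moore_neq0.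
Qed.

Hypothesis a_neq0 : exists i, phi (w i) != 0.

Let ker := [pred e : E | val_phi e == 0].

(** The points of the kernel are [q ^ n.-1] distinct roots, which the degree bound allows only if
    they are all the roots, each simple. *)
Lemma MoorePhi_prod :
  exists2 c, c != 0 & MoorePhi iota q phi w = c *: \prod_(e | ker e) ('X - (x e)%:P).
Proof.
have cker : #|ker| = (q ^ n.-1)%N by apply: card_linear_form_ker.
pose f := MoorePhi iota q phi w.
(* A coordinate vector outside the kernel; [MoorePhi] does not vanish at the corresponding point, so
   it is a nonzero polynomial. *)
have [e0 e0P] : exists e0, val_phi e0 != 0.
  case: a_neq0 => i ai; exists [ffun j => (j == i)%:R].
  rewrite /val_phi (bigD1 i) //= big1 => [|j /negPf ji].
    by rewrite ffunE eqxx mulr1 addr0.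
  by rewrite ffunE ji mulr0.
have f0 : f != 0.
  apply: contraNneq e0P => f0; have := horner_MoorePhi e0.
  rewrite -/f f0 horner0 => /esym/eqP; rewrite !mulf_eq0 signr_eq0.
  by rewrite (negPf Moore_neq0) fmorph_eq0.
exists (lead_coef f); first by rewrite lead_coef_eq0.
pose rs := [seq x e | e in ker].
have rs_uniq : uniq rs by rewrite map_inj_uniq ?enum_uniq //; apply: lin_comb_inj.
have rs_root : all (root f) rs.
  apply/allP=> y /mapP[e]; rewrite mem_enum => /eqP ke ->.
  by apply/eqP; rewrite horner_MoorePhi ke rmorph0 mulr0.
have sz_rs : size rs = (q ^ n.-1)%N by rewrite size_map -cardE.
rewrite [LHS](@all_roots_prod_XsubC _ f rs) ?uniq_rootsE //.
  by rewrite big_map big_enum.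
(* The upper bound is [size_MoorePhi]; the lower bound counts the distinct roots. *)
apply/eqP; rewrite eqn_leq sz_rs size_MoorePhi.
by rewrite -sz_rs max_poly_roots.
Qed.

Lemma prod_lin_comb_split :
  P = \prod_(e | ker e) ('X - (x e)%:P) * \prod_(e | ~~ ker e) ('X - (x e)%:P).
Proof. by rewrite /P (bigID ker). Qed.

Lemma MoorePhi_dvd : MoorePhi iota q phi w %| MooreX q w.
Proof.
case: MoorePhi_prod => c c0 ->.
by rewrite dvdpZl // MooreX_prod prod_lin_comb_split dvdpZr ?Moore_neq0 // dvdp_mulr.
Qed.

Lemma sum_phi_poles_reduced :
  exists2 c, c != 0 &
    \sum_e (iota (val_phi e))%:P%:F / ('X - (x e)%:P)%:F =
    c%:P%:F / (\prod_(y <- [seq x e | e in predC ker]) ('X - y%:P))%:F.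
Proof.
case: MoorePhi_prod => c c0 fE.
(* The constant of [sum_phi_poles], times the leading constant of [MoorePhi], over that of [MooreX];
   the kernel factors cancel. *)
exists (- (Moore q w ^+ (q - 1)) * c / Moore q w).
  by rewrite !mulf_neq0 ?invr_eq0 ?oppr_eq0 ?expf_neq0 ?Moore_neq0.
have -> : \prod_(y <- [seq x e | e in predC ker]) ('X - y%:P) =
          \prod_(e | ~~ ker e) ('X - (x e)%:P) by rewrite big_map big_enum.
rewrite sum_phi_poles MooreX_prod fE prod_lin_comb_split.
set A := \prod_(e | ker e) _; set D := \prod_(e | _) _.
have A0 : A != 0 by rewrite -size_poly_gt0 size_prod_XsubC_pred.
have D0 : D != 0 by rewrite -size_poly_gt0 size_prod_XsubC_pred.
rewrite mulrA -rmorphN -rmorphN -rmorphM /=; apply/eqP.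
rewrite eqr_div ?tofrac_eq0 ?scaler_eq0 ?mulf_eq0 ?negb_or ?A0 ?D0 ?Moore_neq0 //.
rewrite -!rmorphM tofrac_eq !mul_polyC scalerA -scalerAl scalerA.
by rewrite divfK ?Moore_neq0.
Qed.

Lemma size_support_phi :
  size [seq x e | e in predC ker] = (q ^ (n - 1) * (q - 1))%N.
Proof.
rewrite size_map -cardE; apply/eqP; rewrite -(eqn_add2l #|ker|) cardC card_coeffs.
rewrite (@card_linear_form_ker _ _ a) // mulnBr muln1 -expnSr subn1 prednK //.
by rewrite subnKC // leq_exp2l // leq_pred.
Qed.

End LinearForm.

End MooreDeterminants.

(** * Orders of a constant divided by a product of distinct linear factors *)

Lemma fraction_numden (R : idomainType) (f : {fraction R}) :
  f * tofrac (\d_(repr f)%qT) = tofrac (\n_(repr f)%qT).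
Proof.
rewrite -[f in LHS]reprK; unlock tofrac; rewrite -[LHS]FracField.pi_mul.
apply/eqmodP; rewrite /= FracField.equivfE /FracField.mulf.
by rewrite !numden_Ratio ?mulr1 ?mul1r ?oner_eq0 ?denom_ratioP // reprK mulrC.
Qed.

Section Orders.

Variable K : fieldType.
Implicit Types (P f g : {poly K}).

(** The bound [k < size f] in the maximum loses nothing: a nonconstant P with [P ^+ k] dividing a
    nonzero f forces it by degree. *)
Lemma dvdp_exp_mult_poly P f k :
  (1 < size P)%N -> f != 0 -> (P ^+ k %| f) = (k <= mult_poly P f)%N.
Proof.
move=> sP f0.
have P0 : P != 0 by rewrite -size_poly_gt0 ltnW.
have ltP j : P ^+ j %| f -> (j < size f)%N.
  move/(dvdp_leq f0); apply: leq_trans.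
  rewrite -(prednK (n := size (P ^+ j))) ?size_poly_gt0 ?expf_neq0 //.
  by rewrite ltnS size_exp leq_pmull // -subn1 subn_gt0.
apply/idP/idP=> [Pk|le_k].
  exact: (@leq_bigmax_cond _ (fun j : 'I_(size f) => P ^+ j %| f)
    (fun j => j : nat) (Ordinal (ltP _ Pk)) Pk).
rewrite (dvdp_trans (dvdp_exp2l P le_k)) // /mult_poly.
elim/big_ind: _ => [|i j Pi Pj|//]; first by rewrite expr0 dvd1p.
by rewrite /maxn; case: ifP.
Qed.

Lemma mult_poly_coprime P f g :
    (1 < size P)%N -> f != 0 -> g != 0 -> coprimep P g ->
  mult_poly P (f * g) = mult_poly P f.
Proof.
move=> sP f0 g0 cPg; apply/eqP; rewrite eqn_leq.
have fg0 : f * g != 0 by rewrite mulf_neq0.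
rewrite -!dvdp_exp_mult_poly //; apply/andP; split.
  rewrite -(Gauss_dvdpl _ (coprimep_expl _ cPg)).
  by rewrite dvdp_exp_mult_poly.
by rewrite dvdp_mulr // dvdp_exp_mult_poly.
Qed.

Lemma mult_poly_mul P f :
  (1 < size P)%N -> f != 0 -> mult_poly P (f * P) = (mult_poly P f).+1.
Proof.
move=> sP f0; have P0 : P != 0 by rewrite -size_poly_gt0 ltnW.
have fP0 : f * P != 0 by rewrite mulf_neq0.
apply/eqP; rewrite eqn_leq -!dvdp_exp_mult_poly //.
rewrite exprSr dvdp_mul2r // dvdp_exp_mult_poly // leqnn andbT.
case E : (mult_poly P (f * P)) => [//|m].
rewrite ltnS -dvdp_exp_mult_poly // -(dvdp_mul2r _ _ P0) -exprSr.
by rewrite dvdp_exp_mult_poly // E.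
Qed.

Variables (c : K) (rs : seq K).
Hypotheses (c_neq0 : c != 0) (rs_uniq : uniq rs).

Let D := \prod_(y <- rs) ('X - y%:P).
Let om : Omega1 K := c%:P%:F / D%:F.
Let num := \n_(repr om)%qT.
Let den := \d_(repr om)%qT.

Let D0 : D != 0.
Proof. by rewrite -size_poly_gt0 size_prod_XsubC. Qed.

Let den0 : den != 0. Proof. exact: denom_ratioP. Qed.

(** The representative chosen by [repr] may not be in lowest terms: its denominator is D times its
    numerator up to a constant, and that common factor cancels in every order. *)
Let denE : den = c^-1 *: (num * D).
Proof.
have : num * D = c *: den.
  apply/eqP; rewrite -tofrac_eq -mul_polyC !rmorphM /= -fraction_numden.
  by rewrite -/den mulrAC /om divfK ?tofrac_eq0.
by move=> ->; rewrite scalerA mulVf // scale1r.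
Qed.

Let num0 : num != 0.
Proof. by apply: contraNneq den0 => n0; rewrite denE n0 mul0r scaler0. Qed.

Lemma mult_polyZ P f a : a != 0 -> mult_poly P (a *: f) = mult_poly P f.
Proof.
move=> a0; rewrite /mult_poly size_scale //.
by apply: eq_bigl => k; rewrite dvdpZr.
Qed.

Lemma ord_form_inverse_finite P : P \is monic -> irreducible_poly P ->
  ord_form (FinitePlace P) om =
  if has (fun y => P == 'X - y%:P) rs then - 1 else 0.
Proof.
move=> mP iP; have sP : (1 < size P)%N by case: iP.
have nd0 : num * D != 0 by rewrite mulf_neq0.
rewrite /ord_form /ord_ratfun /coord_dX subr0 -/num -/den denE.
rewrite mult_polyZ ?invr_eq0 //.
case: ifP => [/hasP[y y_rs /eqP PE]|/negbT/hasPn Pn].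
  (* As [rs] has no repetition, P is coprime to [D'] and divides D exactly once. *)
  pose D' := \prod_(z <- rem y rs) ('X - z%:P).
  have DE : D = D' * P by rewrite /D (big_rem y) //= -PE mulrC.
  have D'0 : D' != 0 by rewrite -size_poly_gt0 size_prod_XsubC.
  rewrite DE mulrA mult_poly_mul ?mulf_neq0 // mult_poly_coprime //.
    by rewrite -addn1 PoszD opprD addNKr.
  rewrite irreducible_poly_coprime // PE dvdp_XsubCl root_prod_XsubC.
  by rewrite mem_rem_uniq // inE eqxx.
rewrite mult_poly_coprime ?subrr // irreducible_poly_coprime //.
apply/negP=> PD.
have : coprimep P D.
  rewrite /D; elim: (rs) Pn => [|z s IHs] Pn; first by rewrite big_nil coprimep1.
  rewrite big_cons coprimepMr IHs ?andbT; last first.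
    by move=> y ys; apply: Pn; rewrite inE ys orbT.
  rewrite irreducible_poly_coprime //; apply: contra (Pn z (mem_head _ _)) => Pz.
  rewrite -eqp_monic ?monicXsubC //.
  (* A nonconstant divisor of the irreducible ['X - z%:P] is associated to it, and equal to it when
     monic. *)
  have [_ /(_ P)] := irredp_XsubC z; apply=> //.
  by rewrite neq_ltn sP orbT.
by rewrite irreducible_poly_coprime // PD.
Qed.

Lemma ord_form_inverse_infinite :
  ord_form InfinitePlace om = (size rs)%:Z - 2.
Proof.
rewrite /ord_form /ord_ratfun /coord_dX -/num -/den denE.
rewrite size_scale ?invr_eq0 // size_mul // /D size_prod_XsubC addnS /= PoszD.
by rewrite [(size num)%:Z + _]addrC addrK.
Qed.

(** Finite orders are 0 or -1, so zeros occur only at infinity, with order [mu.+1 - 2]. *)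
Lemma zero_divisor_inverse mu : size rs = mu.+1 -> (2 <= mu)%N ->
  zero_divisor_at_infinity mu om.
Proof.
move=> szr mu2 [P [mP iP]|_]; rewrite /zero_order.
  by rewrite ord_form_inverse_finite //; case: ifP.
rewrite ord_form_inverse_infinite szr.
have -> : mu.+1%:Z - 2 = mu%:Z - 1 by rewrite -addn1 PoszD -addrA.
by rewrite max_r // subr_ge0 lez_nat (leq_trans _ mu2).
Qed.

Lemma simple_poles_inverse mu : size rs = mu.+1 -> (2 <= mu)%N ->
  simple_rational_poles om.
Proof.
move=> szr mu2 [P [[mP iP]]|[_]].
  rewrite ord_form_inverse_finite //; case: ifP => // /hasP[y _ /eqP ->] _.
  by split=> //; exists y.
rewrite ord_form_inverse_infinite szr subr_lt0 ltz_nat.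
by rewrite ltnNge (leq_trans mu2).
Qed.

End Orders.

(** * Residues of sums of simple fractions *)

Section Residues.

Variables (K : fieldType) (z : K).

Lemma regular_at_poly (f : {poly K}) : regular_at z f%:F.
Proof. by exists f, 1; rewrite hornerC oner_neq0 rmorph1 divr1. Qed.

Lemma regular_atD f g : regular_at z f -> regular_at z g -> regular_at z (f + g).
Proof.
move=> [a [b [bz ->]]] [a' [b' [b'z ->]]].
exists (a * b' + a' * b), (b * b'); rewrite hornerM mulf_neq0 //; split=> //.
rewrite addf_div ?tofrac_eq0; last first.
- by apply: contraNneq b'z => ->; rewrite horner0.
- by apply: contraNneq bz => ->; rewrite horner0.
by rewrite rmorphD !rmorphM.
Qed.

(** The terms with pole at [z] form the whole polar part, of order 1, and the other terms are
    regular at [z]. Several indices may share a pole, whence the sum over a fibre of [x]. *)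
Lemma residue_sum_simple_poles (E : finType) (x c : E -> K) :
  is_residue z (\sum_e (c e)%:P%:F / ('X - (x e)%:P)%:F : Omega1 K)
    (\sum_(e | x e == z) c e).
Proof.
exists 1%N, (fun _ => \sum_(e | x e == z) c e); split=> //.
rewrite big_nat1 expr1 /coord_dX (bigID (fun e => x e == z)) /=.
rewrite [X in X + _ - _](_ : _ =
  (\sum_(e | x e == z) c e)%:P%:F / ('X - z%:P)%:F); last first.
  by rewrite !rmorph_sum mulr_suml; apply: eq_bigr => e /eqP ->.
rewrite addrAC subrr add0r; apply: big_ind.
- by rewrite -(rmorph0 (@tofrac _)); apply: regular_at_poly.
- exact: regular_atD.
- move=> e xe; exists (c e)%:P, ('X - (x e)%:P); split=> //.
  by rewrite hornerXsubC subr_eq0 eq_sym.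
Qed.

End Residues.

(** * The forms [omega_phi] and the space they span *)

Section Omega.

Variables (F : finFieldType) (K : fieldType) (iota : {rmorphism F -> K}).
Variables (n : nat) (w : 'I_n -> K).

Lemma omega_phiE (alpha : 'I_n -> F) :
  omega_phi iota w alpha =
  \sum_(eps : {ffun 'I_n -> F})
    ((iota (\sum_(j < n) alpha j * eps j))%:P%:F /
     ('X - (\sum_(i < n) iota (eps i) * w i)%:P)%:F) *: dX K.
Proof.
rewrite /omega_phi /Omega_scale /omega.
under eq_bigr do rewrite scaler_sumr.
rewrite exchange_big /=; apply: eq_bigr => eps _.
rewrite !rmorph_sum mulr_suml scaler_suml; apply: eq_bigr => j _.
by rewrite scalerA mulrA !rmorphM.
Qed.

End Omega.

Theorem proposition3p1 (p s q : nat) (F : finFieldType) (K : fieldType)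
    (iota : {rmorphism F -> K}) (n : nat) (W : K -> Prop) (w : 'I_n -> K)
    (wstar : 'I_n -> K -> F)
    (hp : prime p) (hq : q = (p ^ s)%N) (hF : #|F| = q) (hn : (1 <= n)%N)
    (hw : is_Fbasis (Fscale iota) W w) (hstar : is_dual_basis iota W w wstar) :
  (forall alpha : 'I_n -> F, (exists i, alpha i != 0) ->
     let phi : K -> F := fun v => \sum_(i < n) alpha i * wstar i v in
     [/\ omega_phi iota w alpha =
           \sum_(eps : {ffun 'I_n -> F})
             ((iota (\sum_(j < n) alpha j * eps j))%:P%:F /
              ('X - (\sum_(i < n) iota (eps i) * w i)%:P)%:F) *: dX K,
         omega_phi iota w alpha =
           (- (Moore q w ^+ (q - 1))%:P%:F *
              ((MoorePhi iota q phi w)%:F / (MooreX q w)%:F))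
             *: dX K
       & MoorePhi iota q phi w %| MooreX q w]) /\
  (forall mu : nat, mu.+1 = (q ^ (n - 1) * (q - 1))%N ->
     (2 <= mu)%N -> coprime mu p ->
     is_Lspace iota p mu n (Omega_W iota w)).
Proof.
have [_ w_indep] := hw; have [_ dual] := hstar.
rewrite -hF; move: hF; rewrite hq => cardF.
pose phi (alpha : 'I_n -> F) (v : K) := \sum_(i < n) alpha i * wstar i v.
(* Duality recovers the coefficients [alpha] as the values of [phi alpha] on the basis. *)
have phi_w alpha j : phi alpha (w j) = alpha j.
  rewrite /phi (bigD1 j) //= dual eqxx mulr1 big1 ?addr0 // => i /negPf ij.
  by rewrite dual ij mulr0.
have phi_neq0 alpha : (exists i, alpha i != 0) ->
    exists i, phi alpha (w i) != 0.
  by case=> i ai; exists i; rewrite phi_w.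
have coord alpha : omega_phi iota w alpha =
    \sum_(e : {ffun 'I_n -> F})
      (iota (\sum_j phi alpha (w j) * e j))%:P%:F /
      ('X - (\sum_i iota (e i) * w i)%:P)%:F.
  rewrite omega_phiE; apply: eq_bigr => e _; rewrite [LHS]mulr1.
  by congr ((iota _)%:P%:F / _); apply: eq_bigr => j _; rewrite phi_w.
split=> [alpha alpha_neq0 phi0|mu mu_eq mu2 mu_p].
  split; first exact: omega_phiE.
    by rewrite coord (sum_phi_poles hp cardF hn w_indep) [RHS]mulr1.
  exact: (MoorePhi_dvd hp cardF hn w_indep (phi_neq0 _ alpha_neq0)).
(* The reduced shape serves for independence, zeros and poles alike; [rs] lists the [mu.+1] points
   of W outside the kernel. *)
have omega_phi_reduced alpha : (exists i, alpha i != 0) ->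
    exists c rs, [/\ c != 0, uniq rs, size rs = mu.+1 &
      omega_phi iota w alpha = c%:P%:F / (\prod_(y <- rs) ('X - y%:P))%:F].
  move=> /phi_neq0 a0.
  have [c c0 E] := sum_phi_poles_reduced hp cardF hn w_indep a0.
  eexists c, _; split; [exact: c0| | |by rewrite coord E].
    rewrite map_inj_uniq ?enum_uniq //; exact: lin_comb_inj w_indep.
  by rewrite (size_support_phi iota hn a0).
split=> //.
  exists (omega iota w); split=> // alpha alpha0 i; apply/eqP.
  apply: contraT => ai.
  (* A relation with a nonzero coefficient would equate 0 with a nonzero constant over a nonzero
     product. *)
  have [|c [rs [c0 _ _]]] := omega_phi_reduced alpha; first by exists i.
  rewrite [LHS]alpha0 => /esym/eqP; rewrite mulf_eq0 invr_eq0 !tofrac_eq0.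
  by rewrite polyC_eq0 (negPf c0) -size_poly_eq0 size_prod_XsubC.
move=> om [alpha omE] om0.
have a0 : exists i, alpha i != 0.
  apply/existsP; apply: contraR om0 => /existsPn a0; rewrite omE /Flincomb.
  rewrite big1 // => i _; have /negPn/eqP -> := a0 i.
  by rewrite /Omega_scale !rmorph0 scale0r.
have {}omE : om = omega_phi iota w alpha := omE.
have [c [rs [c0 rs_uniq szr E]]] := omega_phi_reduced _ a0.
split.
- by rewrite omE E; apply: zero_divisor_inverse.
- by rewrite omE E; apply: simple_poles_inverse szr mu2.
move=> z _; rewrite omE coord.
(* The residue is a sum of values of the linear form, hence comes from F. *)
exists (\sum_(e : {ffun 'I_n -> F} | \sum_i iota (e i) * w i == z)
   \sum_j phi alpha (w j) * e j).
by rewrite rmorph_sum; apply: residue_sum_simple_poles.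
Qed.
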